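(* Let $\mathcal{T}^h$ be a mesh of $\Omega$ with elements denoted $\Delta$, and let $u_\epsilon^h\in X^h$ be the solution of the pointwise penalty (PP) method, i.e. $$\int_\Omega\nu\nabla u_\epsilon^h:\nabla v^h\,dx+\sum_{\Delta}\frac{1}{\mathrm{LocTol}_\Delta}\int_\Delta |\nabla\cdot u_\epsilon^h|^2\,(\nabla\cdot u_\epsilon^h)(\nabla\cdot v^h)\,dx=\int_\Omega f\cdot v^h\,dx\qquad\text{for all } v^h\in X^h .$$ Then $u_\epsilon^h$ is stable in the sense that the following bound holds: $$\frac{\nu}{2}\|\nabla u_\epsilon^h\|^2+\sum_{\Delta}\frac{1}{\mathrm{LocTol}_\Delta}\|\nabla\cdot u_\epsilon^h\|_{L^4(\Delta)}^4\leq\frac{1}{2\nu}\|f\|_{-1}^2 .$$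
   Context: $\Omega\subset\mathbb{R}^d$, $d\in\{2,3\}$, is a bounded open polygonal (polyhedral) domain; $\nu>0$ is the viscosity; $f$ is a given body force with finite norm $\|f\|_{-1}$. $X=(H_0^1(\Omega))^d$, and $X^h\subset X$ is a finite element space of continuous piecewise polynomial vector fields based on a conforming partition $\mathcal{T}^h$ of $\Omega$ into finitely many elements $\Delta$; sums $\sum_\Delta$ run over all elements of $\mathcal{T}^h$. $|D|$ denotes the area/volume of a region $D$. $\mathrm{TOL}>0$ is a given global tolerance, and the local tolerance is $\mathrm{LocTol}_\Delta=\frac12\,\mathrm{TOL}^2\,\frac{|\Delta|}{|\Omega|}$. $\|\cdot\|$ is the $L^2(\Omega)$ norm, $(\cdot,\cdot)$ is the $L^2(\Omega)$ inner product (or the duality pairing when $f$ is only in the dual space; $\int_\Omega f\cdot v\,dx$ means $(f,v)$), and $\|f\|_{-1}=\sup_{0\neq v\in X}\frac{(f,v)}{\|\nabla v\|}$. *)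

(* Defs.v *)
From HB Require Import structures.
From mathcomp Require Import all_boot all_order all_algebra.
From mathcomp Require Import all_classical all_reals all_analysis.
(* Not imported: the notations of mpoly clash with those of MathComp-Analysis. *)
From mathcomp Require mpoly.

Set Implicit Arguments.
Unset Strict Implicit.
Unset Printing Implicit Defensive.

Import Order.TTheory GRing.Theory Num.Theory.
Import numFieldNormedType.Exports.

Local Open Scope classical_set_scope.
Local Open Scope ring_scope.

(* R^n is ['rV[R]_n].  Its sigma-algebra is generated by the coordinate
   functions, i.e. it is the product of the Borel sigma-algebras of R, which
   is the Borel sigma-algebra of R^n. *)
Definition rV_display : measure_display -> measure_display.
Proof. exact. Qed.

Section measurable_rV.
Context {R : realType} (n : nat).

Let coord (i : 'I_n) (x : 'rV[R]_n) : measurableTypeR R := x 0 i.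

Let rV_set0 : g_sigma_preimage coord set0.
Proof. exact: sigma_algebra0. Qed.

Let rV_setC A : g_sigma_preimage coord A -> g_sigma_preimage coord (~` A).
Proof. exact: sigma_algebraC. Qed.

Let rV_bigcup (F : (set 'rV[R]_n)^nat) :
  (forall i, g_sigma_preimage coord (F i)) ->
  g_sigma_preimage coord (\bigcup_i (F i)).
Proof. exact: sigma_algebra_bigcup. Qed.

HB.instance Definition _ :=
  @isMeasurable.Build (rV_display (R.-ocitv.-measurable).-sigma)
    'rV[R]_n (g_sigma_preimage coord) rV_set0 rV_setC rV_bigcup.

End measurable_rV.

Section measurable_rV_lemmas.
Context {R : realType}.

Lemma measurable_coord n (i : 'I_n) :
  measurable_fun [set: 'rV[R]_n] (fun x => x 0 i : measurableTypeR R).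
Proof.
move=> _ Y mY; rewrite setTI; apply: sub_sigma_algebra => /=.
rewrite -bigcup_seq/=; exists i => /=; first by rewrite mem_index_enum.
by exists Y => //; rewrite setTI.
Qed.

Lemma measurable_fun_rV d (T : measurableType d) n (f : T -> 'rV[R]_n) :
  (forall i, measurable_fun [set: T] (fun x => f x 0 i : measurableTypeR R)) ->
  measurable_fun [set: T] f.
Proof.
move=> mf _ A mA; rewrite setTI.
suff : [set A | measurable (f @^-1` A)] A by [].
move: A mA; apply: smallest_sub.
  split => /=.
  - by rewrite preimage_set0.
  - by move=> A mA; rewrite setTD preimage_setC; exact: measurableC.
  - by move=> F mF; rewrite preimage_bigcup; exact: bigcup_measurable.
rewrite -bigcup_seq/=; apply: bigcup_sub => i _ A [B mB <-] /=.
by rewrite setTI -[X in measurable X]setTI; exact: (mf i).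
Qed.

End measurable_rV_lemmas.

Section lebesgue_rV_step.
Context {R : realType} (n : nat).
Variable mu : {sigma_finite_measure set 'rV[R]_n -> \bar R}.

Definition consrV (p : measurableTypeR R * 'rV[R]_n) : 'rV[R]_n.+1 :=
  \row_i (if unlift ord0 i is Some j then p.2 0 j else p.1).

Definition unconsrV (x : 'rV[R]_n.+1) : measurableTypeR R * 'rV[R]_n :=
  (x 0 ord0, \row_j x 0 (lift ord0 j)).

Lemma consrVK : cancel consrV unconsrV.
Proof.
case=> a v; rewrite /unconsrV /consrV mxE unlift_none /=; congr pair.
by apply/rowP => j; rewrite !mxE liftK.
Qed.

Lemma unconsrVK : cancel unconsrV consrV.
Proof.
move=> x; apply/rowP => i; rewrite mxE.
by case: unliftP => [j|] -> /=; rewrite ?mxE.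
Qed.

Lemma measurable_consrV : measurable_fun [set: _] consrV.
Proof.
apply: measurable_fun_rV => i; rewrite /consrV.
under eq_fun do rewrite mxE.
case: unliftP => [j|] _; last exact: measurable_fst.
apply: (@measurableT_comp _ _ _ _ _ _ (fun x : 'rV[R]_n => x 0 j)) => //.
exact: measurable_coord.
Qed.

Lemma measurable_unconsrV : measurable_fun [set: _] unconsrV.
Proof.
apply: measurable_fun_pair; first exact: measurable_coord.
apply: measurable_fun_rV => i.
by under eq_fun do rewrite mxE; exact: measurable_coord.
Qed.

Definition lebesgue_rVS : set 'rV[R]_n.+1 -> \bar R :=
  pushforward (lebesgue_measure \x mu)%E consrV.

Let lebesgue_rVS0 : lebesgue_rVS set0 = 0%E.
Proof. by rewrite /lebesgue_rVS /pushforward preimage_set0 measure0. Qed.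

Let lebesgue_rVS_ge0 A : (0 <= lebesgue_rVS A)%E.
Proof. by rewrite /lebesgue_rVS /pushforward; exact: measure_ge0. Qed.

Let lebesgue_rVS_sigma_additive : semi_sigma_additive lebesgue_rVS.
Proof.
have mc A : measurable A -> measurable (consrV @^-1` A).
  by move=> mA; rewrite -[X in measurable X]setTI; exact: measurable_consrV.
move=> F mF tF mUF; rewrite /lebesgue_rVS /pushforward preimage_bigcup.
apply: measure_semi_sigma_additive; first by move=> k; exact: mc.
- apply/trivIsetP => /= i j _ _ ij; rewrite -preimage_setI.
  by move/trivIsetP : tF => /(_ _ _ _ _ ij) ->//; rewrite preimage_set0.
- by rewrite -preimage_bigcup; exact: mc.
Qed.

HB.instance Definition _ := isMeasure.Build _ _ _ lebesgue_rVS
  lebesgue_rVS0 lebesgue_rVS_ge0 lebesgue_rVS_sigma_additive.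

Let lebesgue_rVS_sigma_finite : sigma_finite setT lebesgue_rVS.
Proof.
have /sigma_finiteP[F [TF ndF Foo]] :=
  sigma_finiteT (lebesgue_measure : {sigma_finite_measure set _ -> \bar R}).
have /sigma_finiteP[G [TG ndG Goo]] := sigma_finiteT mu.
exists (fun k => unconsrV @^-1` (F k `*` G k)).
  rewrite -preimage_bigcup; apply/esym/seteqP; split => // x _ /=.
  have [k _ Fk] : (\bigcup_k F k) (unconsrV x).1 by rewrite -TF.
  have [l _ Gl] : (\bigcup_k G k) (unconsrV x).2 by rewrite -TG.
  exists (maxn k l) => //; split.
    by move: Fk; exact/subsetPset/ndF/leq_maxl.
  by move: Gl; exact/subsetPset/ndG/leq_maxr.
move=> k; have [mF Fk] := Foo k; have [mG Gk] := Goo k; split.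
  rewrite -[X in measurable X]setTI; apply: measurable_unconsrV => //.
  exact: measurableX.
rewrite /lebesgue_rVS /pushforward -comp_preimage.
have -> : unconsrV \o consrV = id by apply/funext => p /=; rewrite consrVK.
by rewrite preimage_id product_measure1E// lte_mul_pinfty// ge0_fin_numE.
Qed.

HB.instance Definition _ := Measure_isSigmaFinite.Build _ _ _ lebesgue_rVS
  lebesgue_rVS_sigma_finite.

End lebesgue_rV_step.

Fixpoint lebesgue_rV (R : realType) (n : nat) :
    {sigma_finite_measure set 'rV[R]_n -> \bar R} :=
  if n is n'.+1 return {sigma_finite_measure set 'rV[R]_n -> \bar R}
  then lebesgue_rVS (lebesgue_rV R n')
  else \d_(0 : 'rV[R]_0).

Lemma lebesgue_rV_box (R : realType) n (a b : 'rV[R]_n) :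
  (forall i, a 0 i <= b 0 i) ->
  lebesgue_rV R n [set x | forall i, a 0 i <= x 0 i <= b 0 i] =
  (\prod_i (b 0 i - a 0 i))%:E.
Proof.
elim: n a b => [|n IH] a b ab.
  by rewrite big_ord0 /= diracE mem_set// => -[].
pose tl (x : 'rV[R]_n.+1) : 'rV[R]_n := \row_j x 0 (lift ord0 j).
pose B := [set x : 'rV[R]_n | forall i, tl a 0 i <= x 0 i <= tl b 0 i].
have mB : measurable B.
  have -> : B = \bigcap_(i in [set: 'I_n])
      ((fun x : 'rV[R]_n => x 0 i) @^-1` `[tl a 0 i, tl b 0 i]).
    by apply/seteqP; split => x /= xB i; [|have := xB i I];
      rewrite /= in_itv/=; auto.
  apply: fin_bigcap_measurable => // i _.
  by rewrite -[X in measurable X]setTI; apply: measurable_coord => //;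
    exact: measurable_itv.
rewrite big_ord_recl /= /lebesgue_rVS /pushforward.
have -> : consrV (R := R) (n := n) @^-1`
    [set x | forall i, a 0 i <= x 0 i <= b 0 i] =
    `[a 0 ord0, b 0 ord0] `*` B.
  apply/seteqP; split => [[x v] /= xv|[x v] /= [xab vB] i].
    split; first by have := xv ord0; rewrite mxE unlift_none in_itv.
    by move=> i; have := xv (lift ord0 i); rewrite !mxE liftK.
  rewrite mxE; case: unliftP => [j|] -> /=; last by move: xab; rewrite in_itv.
  by have := vB j; rewrite !mxE.
rewrite product_measure1E// IH; last by move=> i; rewrite !mxE.
rewrite EFinM; congr (_ * _)%E; last first.
  by congr EFin; apply: eq_bigr => i _; rewrite !mxE.
apply: (etrans (lebesgue_measure_itv _)) => /=; rewrite lte_fin.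
case: ltP => [//|ba].
by rewrite (@le_anti _ _ (a 0 ord0) (b 0 ord0)) ?ab ?ba// subrr.
Qed.

Definition volume (R : realType) n (D : set 'rV[R]_n) : R :=
  fine (lebesgue_rV R n D).

Section sobolev.
Context {R : realType} {d : nat}.
Local Notation E := 'rV[R]_d.
Local Notation mu := (lebesgue_rV R d).
Implicit Types (D Om : set E) (g h v phi : E -> R).

Definition Lp_norm (p : \bar R) D g : \bar R := 'N[mu]_p[EFin \o (g \_ D)].

Definition L2 D g : Prop := g \_ D \in Lfun mu 2%:E.

Definition partial (i : 'I_d) phi : E -> R := 'D_('e_i) phi.

(* All iterated partial derivatives exist everywhere and are continuous. *)
Definition smooth phi : Prop :=
  forall (s : seq 'I_d) (i : 'I_d),
    continuous (foldr partial phi s) /\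
    forall x, derivable (foldr partial phi s) x 'e_i.

(* C_c^oo(Om), its elements being extended by 0 to R^d *)
Definition test_function Om phi : Prop :=
  let support := closure [set x | phi x != 0] in
  [/\ smooth phi, compact support & support `<=` Om].

Definition is_weak_partial Om (i : 'I_d) v g : Prop :=
  forall phi, test_function Om phi ->
    \int[mu]_(x in Om) (v x * partial i phi x) =
    - \int[mu]_(x in Om) (g x * phi x).

(* A representative of the weak derivative in L^2(Om), which is unique up to
   equality almost everywhere in Om; meaningful for v in H^1(Om). *)
Definition weak_partial Om (i : 'I_d) v : E -> R :=
  get [set g | L2 Om g /\ is_weak_partial Om i v g].

Definition H1 Om v : Prop :=
  L2 Om v /\ forall i, exists g, L2 Om g /\ is_weak_partial Om i v g.

(* H^1_0(Om) is the closure of C_c^oo(Om) in H^1(Om). *)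
Definition H10 Om v : Prop :=
  H1 Om v /\
  forall e : R, 0 < e -> exists phi,
    [/\ test_function Om phi,
        (Lp_norm 2%:E Om (phi \- v)%R < e%:E)%E &
        forall i,
          (Lp_norm 2%:E Om (partial i phi \- weak_partial Om i v)%R
            < e%:E)%E].

End sobolev.

Section vector_fields.
Context {R : realType} {d : nat}.
Local Notation E := 'rV[R]_d.
Local Notation mu := (lebesgue_rV R d).
Implicit Types (Om : set E) (u v : E -> E).

Definition component (i : 'I_d) v : E -> R := fun x => v x 0 i.

Definition spaceX Om : set (E -> E) := [set v | forall i, H10 Om (component i v)].

Definition grad Om v (x : E) : 'M[R]_d :=
  \matrix_(i, j) weak_partial Om j (component i v) x.

Definition divergence Om v (x : E) : R := \tr (grad Om v x).

Definition ddot (A B : 'M[R]_d) : R := \sum_i \sum_j A i j * B i j.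

Definition grad_norm Om v : R :=
  fine (Lp_norm 2%:E Om (fun x => Num.sqrt (ddot (grad Om v x) (grad Om v x)))).

(* f : v |-> (f, v) is a bounded linear functional on X, X being normed by
   [grad_norm], i.e. f is in the dual of X. *)
Definition dualX Om (f : (E -> E) -> R) : Prop :=
  (forall (a : R) v w, spaceX Om v -> spaceX Om w ->
    f (a *: v + w) = a * f v + f w) /\
  exists C : R, forall v, spaceX Om v -> `|f v| <= C * grad_norm Om v.

Definition dual_norm Om (f : (E -> E) -> R) : R :=
  sup [set f v / grad_norm Om v | v in
    [set v | spaceX Om v /\ ~ {ae mu, forall x, Om x -> v x = 0}]].

End vector_fields.

Section meshes.
Context {R : realType} {d : nat}.
Local Notation E := 'rV[R]_d.

Definition convex_hull m (p : 'I_m -> E) : set E :=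
  [set x | exists w : 'I_m -> R,
    [/\ forall i, 0 <= w i, \sum_i w i = 1 & x = \sum_i w i *: p i]].

Definition affinely_independent m (p : 'I_m -> E) : Prop :=
  forall w : 'I_m -> R,
    \sum_i w i = 0 -> \sum_i w i *: p i = 0 -> forall i, w i = 0.

(* The convex hull of d affinely independent points: a segment of the plane
   for d = 2, a triangle of R^3 for d = 3. *)
Definition facet_simplex (A : set E) : Prop :=
  exists p : 'I_d -> E, affinely_independent p /\ A = convex_hull p.

Definition polytopal_domain (Om : set E) : Prop :=
  [/\ open Om, connected Om, Om !=set0, bounded_set Om &
      exists (m : nat) (S : 'I_m -> set E),
        (forall k, facet_simplex (S k)) /\
        closure Om `\` Om = \bigcup_k S k].

(* Mesh elements are closed. *)
Definition convex_polytope (A : set E) : Prop :=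
  (exists (m : nat) (p : 'I_m -> E), A = convex_hull p) /\ interior A !=set0.

(* F is the set where a linear form attains its maximum c over A; b = 0 gives
   the improper faces set0 and A. *)
Definition face (F A : set E) : Prop :=
  exists (b : E) (c : R),
    (forall x, A x -> \sum_i b 0 i * x 0 i <= c) /\
    F = A `&` [set x | \sum_i b 0 i * x 0 i = c].

(* Since T is injective and the elements have nonempty interiors, the common
   face of two elements is a proper one, so the interiors are disjoint. *)
Definition conforming_mesh (Om : set E) N (T : 'I_N -> set E) : Prop :=
  [/\ injective T, forall K, convex_polytope (T K),
      \bigcup_K T K = closure Om &
      forall K L, face (T K `&` T L) (T K)].

Definition poly_degree_le (k : nat) (p : mpoly.mpoly d R) : Prop :=
  forall m, (k < mpoly.mdeg m)%N -> mpoly.mcoeff m p = 0.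

(* The degree bound k makes the space finite dimensional. *)
Definition fe_space (Om : set E) N (T : 'I_N -> set E) (Xh : set (E -> E)) :
    Prop :=
  [/\ Xh `<=` spaceX Om,
      Xh 0,
      forall (a : R) v w, Xh v -> Xh w -> Xh (a *: v + w) &
      exists k : nat, forall v, Xh v ->
        {within closure Om, continuous v} /\
        forall (K : 'I_N) (i : 'I_d), exists p : mpoly.mpoly d R,
          poly_degree_le k p /\
          forall x, T K x -> v x 0 i = mpoly.meval (fun j => x 0 j) p].

End meshes.

Section pp_method.
Context {R : realType} {d : nat}.
Local Notation E := 'rV[R]_d.
Local Notation mu := (lebesgue_rV R d).

Definition LocTol (Om : set E) (TOL : R) (D : set E) : R :=
  2^-1 * TOL ^+ 2 * (volume D / volume Om).

Definition pp_solution (nu TOL : R) (Om : set E) N (T : 'I_N -> set E)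
    (Xh : set (E -> E)) (f : (E -> E) -> R) (u : E -> E) : Prop :=
  Xh u /\
  forall v, Xh v ->
    \int[mu]_(x in Om) (nu * ddot (grad Om u x) (grad Om v x)) +
    \sum_(K < N) (LocTol Om TOL (T K))^-1 *
      \int[mu]_(x in T K)
        (`|divergence Om u x| ^+ 2 * (divergence Om u x * divergence Om v x))
    = f v.

End pp_method.

(* Main.v *)
Require Import Defs.
From mathcomp Require Import all_boot all_order all_algebra.
From mathcomp Require Import all_classical all_reals all_analysis.
From mathcomp Require Import measurable_realfun.
From mathcomp Require Import ring lra.

(** The bound is the energy estimate obtained by testing the scheme with
    its own solution [u].  Writing [G] for the gradient norm of [u], [F] for
    the dual norm of [f] and [S] for the weighted sum of the fourth powers of
    the L^4 norms of the divergence, the test [v = u] reads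
    [nu * G ^+ 2 + S = f u], and
    [f u <= F * G <= nu / 2 * G ^+ 2 + F ^+ 2 / (2 * nu)] by duality
    ([dual_norm_bound]) and Young's inequality; half of the viscous term is
    then absorbed on the left.

    The integrals of the scheme are powers of Lebesgue norms by
    [fine_LnormX], which holds without any integrability: the real value of
    an infinite integral or norm is 0 on both sides.

    The delicate point is the duality bound.  The supremum defining [F] only
    ranges over the fields that are not almost everywhere zero, so a field [v]
    that vanishes almost everywhere must be shown to have a zero gradient norm
    ([grad_norm_ae0]); the boundedness of [f] then gives [f v = 0].  The weak
    derivative [w] of such a field is orthogonal to every test function, and
    because [v] is in H^1_0, [w] is also a limit in L^2 of derivatives of test
    functions, which are test functions themselves.  Hence [w] is orthogonal
    to itself ([Lfun2_sqr_eq0], [weak_partial_ae0]).  This is where the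
    definition of H^1_0 as a closure replaces the fundamental lemma of the
    calculus of variations. *)

Set Implicit Arguments.
Unset Strict Implicit.
Unset Printing Implicit Defensive.

Import Order.TTheory GRing.Theory Num.Theory.
Import numFieldNormedType.Exports.

Local Open Scope classical_set_scope.
Local Open Scope ring_scope.

(** * Borel sets of the space of row vectors *)

Section borel_rV.
Context {R : realType} {n : nat}.
Implicit Types (U : set 'rV[R]_n) (g : 'rV[R]_n -> R).

Lemma measurable_ball_rV (x : 'rV[R]_n) (r : R) : 0 < r ->
  measurable (ball x r).
Proof.
move=> r0.
have -> : ball x r = \bigcap_(i in [set: 'I_n])
    ((fun y : 'rV[R]_n => y 0 i) @^-1` ball (x 0 i) r).
  apply/seteqP; split => [y [_ xy] i _|y xy]; first exact: xy.
  by split => // i j; rewrite ord1; exact: xy.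
apply: fin_bigcap_measurable => // i _.
rewrite -[X in measurable X]setTI; apply: measurable_coord => //.
by apply: open_measurable; exact: ball_open.
Qed.

(** The sigma-algebra is generated by the coordinates, whereas the topology is
    that of the sup norm.  They agree because an open set is the union of the
    balls with rational centre and radius [k.+1%:R^-1] that it contains: a
    countable union of boxes. *)
Lemma open_measurable_rV U : open U -> measurable U.
Proof.
move=> oU.
pose q2r (q : 'rV[rat]_n) : 'rV[R]_n := map_mx ratr q.
pose B (p : 'rV[rat]_n * nat) : set 'rV[R]_n := ball (q2r p.1) p.2.+1%:R^-1.
pose F p : set 'rV[R]_n := if `[< B p `<=` U >] then B p else set0.
have -> : U = \bigcup_p F p.
  apply/seteqP; split => [x Ux|x [p _]]; last first.
    by rewrite /F; case: asboolP => // BU Bx; exact: BU.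
  have /nbhs_ballP[e /= e0 xU] := open_nbhs_nbhs (conj oU Ux).
  (* Half the radius: the ball centred at the rational point must contain x
     and stay inside the ball of radius e around x. *)
  have e20 : 0 < e / 2 by rewrite divr_gt0.
  have [k _ /(_ k (leqnn k)) ke'] := near_infty_natSinv_lt (PosNum e20).
  have ke : k.+1%:R^-1 < e / 2 := ke'.
  have k0 : 0 < k.+1%:R^-1 :> R by [].
  have /choice[q qx] : forall i, exists q : rat,
      ball (x 0 i) k.+1%:R^-1 (ratr q : R).
    move=> i; have [_ [/[swap] -[q _ <-] xr]] :
        (ball (x 0 i) k.+1%:R^-1 `&` (@ratr R @` setT)) !=set0.
      apply: dense_rat; last exact: ball_open.
      by exists (x 0 i); exact: ballxx.
    by exists q.
  have xq : ball x k.+1%:R^-1 (q2r (\row_i q i)).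
    by split => // i j; rewrite ord1 !mxE; exact: qx.
  exists (\row_i q i, k) => //; rewrite /F; case: asboolP => [_|[]].
    exact: ball_sym.
  move=> y By; apply: xU.
  apply: (@le_ball _ _ _ (k.+1%:R^-1 + k.+1%:R^-1)).
    by rewrite [leRHS]splitr lerD ?ltW.
  exact: ball_triangle xq By.
apply: countable_bigcupT_measurable => [|p]; first exact: countableP.
by rewrite /F; case: ifP => // _; exact: measurable_ball_rV.
Qed.

Lemma continuous_measurable_rV g : continuous g -> measurable_fun setT g.
Proof.
move=> /continuousP cg.
apply: (measurability _ (RGenOpens.measurableE R)) => _ [_ [a [b ->] <-]].
by rewrite setTI; apply: open_measurable_rV; apply: cg; apply: interval_open.
Qed.

End borel_rV.

(** * Lebesgue norms and orthogonality in L^2 *)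

Section Lebesgue_norms.
Context {d : measure_display} {T : measurableType d} {R : realType}.
Context {mu : {measure set T -> \bar R}}.
Implicit Types (g h : T -> R).

(** No measurability or integrability is required: if the integral is
    infinite then so is the norm, and [fine] sends both to 0. *)
Lemma fine_LnormX (m : nat) g : (0 < m)%N ->
  fine ('N[mu]_(m%:R%:E)[EFin \o g])%E ^+ m = \int[mu]_x (`|g x| ^+ m).
Proof.
move=> m0; have m0R : m%:R != 0 :> R by rewrite pnatr_eq0 -lt0n.
rewrite -powR_mulrn ?fine_ge0 ?Lnorm_ge0//.
rewrite -fine_poweR poweR_Lnorm//; congr fine; apply: eq_integral => x _ /=.
by rewrite powR_mulrn.
Qed.

(** A function in the L^2 closure of its own orthogonal is zero: if [h] is
    orthogonal to [g] then [\int g^2 <= \int (h - g)^2]. *)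
Lemma Lfun2_sqr_eq0 g :
  g \in Lfun mu 2%:E ->
  (forall e : R, 0 < e -> exists h,
     [/\ measurable_fun setT h, \int[mu]_x (g x * h x) = 0 &
         ('N[mu]_2%:E[EFin \o (h \- g)%R] < e%:E)%E]) ->
  \int[mu]_x (g x ^+ 2) = 0.
Proof.
move=> Lg approx; apply/eqP; rewrite eq_le; apply/andP; split; last first.
  by apply: Rintegral_ge0 => x _; exact: sqr_ge0.
apply/ler_addgt0Pl => e e0; rewrite addr0.
have se0 : 0 < Num.sqrt e by rewrite sqrtr_gt0.
have [h [mh gh0 hge]] := approx _ se0.
have mg : measurable_fun setT g.
  by have := sub_Lfun_mfun Lg; rewrite inE.
have Lhg : h \- g \in Lfun mu 2%:E.
  apply/andP; split; rewrite inE /=; first exact: measurable_funB.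
  by apply: (lt_trans hge); rewrite ltry.
have Lh : h \in Lfun mu 2%:E.
  have -> : h = (h \- g) + g by apply/funext => x; rewrite /= addrfctE/= subrK.
  have l12 : (1 <= 2%:E :> \bar R)%E by rewrite lee_fin ler1n.
  exact: (Lfun_addr_closed mu l12).2.
have ig : mu.-integrable setT (EFin \o (fun x => g x ^+ 2)).
  exact: Lfun2_integrable_sqr.
have igh : mu.-integrable setT (EFin \o (fun x => g x * h x)).
  by apply/Lfun1_integrable; exact: Lfun2_mul_Lfun1.
have ihg : mu.-integrable setT (EFin \o (fun x => (h x - g x) ^+ 2)).
  exact: (@Lfun2_integrable_sqr _ _ _ mu (h \- g)).
have : \int[mu]_x (h x - g x) ^+ 2 < e.
  have := @fine_LnormX 2 (h \- g) isT.
  under [in X in _ = X -> _]eq_Rintegral do rewrite real_normK ?num_real//.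
  move=> <-; rewrite -[ltRHS]sqr_sqrtr ?ltW//.
  rewrite ltr_pXn2r ?nnegrE ?fine_ge0 ?Lnorm_ge0 ?ltW//.
  rewrite -lte_fin fineK// ge0_fin_numE ?Lnorm_ge0//.
  by rewrite (lt_trans hge)// ltry.
move/ltW; apply: le_trans.
(* Subtracting the vanishing integral of 2 g h makes the comparison pointwise:
   the difference of the two integrands is h^2. *)
have -> : \int[mu]_x (g x ^+ 2) = \int[mu]_x (g x ^+ 2 - 2 * (g x * h x)).
  rewrite RintegralB// ?RintegralZl// ?gh0 ?mulr0 ?subr0//.
  exact: (integrableZl _ _ igh).
apply: le_Rintegral => //.
  apply: (@integrableB _ _ _ _ _ measurableT (fun x => (g x ^+ 2)%:E)
    (fun x => (2 * (g x * h x))%:E) ig).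
  exact: (integrableZl _ _ igh).
by move=> x _; have := sqr_ge0 (h x); rewrite sqrrB -mulr_natl; lra.
Qed.

End Lebesgue_norms.

(** * Derivatives of test functions *)

Section test_functions.
Context {R : realType} {d : nat}.
Implicit Types (Om : set 'rV[R]_d) (phi : 'rV[R]_d -> R).

(** Off the closed support a function is locally constant, equal to 0. *)
Lemma partial_supp i phi :
  [set x | partial i phi x != 0] `<=` closure [set x | phi x != 0].
Proof.
move=> x /= dx; apply: contrapT => nx; move/eqP: dx; apply.
rewrite /partial (@near_eq_derive _ _ _ phi (cst 0)) ?derive_cst//.
have : open_nbhs x (~` closure [set x | phi x != 0]).
  by split => //; apply: closed_openC; exact: closed_closure.
move=> /open_nbhs_nbhs; apply: filterS => y ny /=.
apply/eqP; apply: contrapT => py.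
by apply: ny; apply: subset_closure; exact/negP.
Qed.

Lemma test_function_partial Om i phi :
  test_function Om phi -> test_function Om (partial i phi).
Proof.
move=> [sphi cphi phiOm].
have sub : closure [set x | partial i phi x != 0] `<=`
    closure [set x | phi x != 0].
  have := closure_subset (@partial_supp i phi).
  by rewrite -((closure_id _).1 (@closed_closure _ _)).
split.
- by move=> s j; have := sphi (rcons s i) j; rewrite foldr_rcons.
- by apply: subclosed_compact cphi sub; exact: closed_closure.
- exact: subset_trans sub phiOm.
Qed.

Lemma test_function_restrict Om phi : test_function Om phi -> phi \_ Om = phi.
Proof.
move=> [_ _ phiOm]; apply/funext => x; rewrite patchE.
case: ifPn => // /negP nx; apply/esym/eqP; apply: contrapT => phix.
by apply: nx; apply/mem_set/phiOm/subset_closure; exact/negP.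
Qed.

Lemma measurable_partial Om i phi :
  test_function Om phi -> measurable_fun setT (partial i phi).
Proof.
move=> [sphi _ _]; apply: continuous_measurable_rV.
exact: (sphi [:: i] i).1.
Qed.

End test_functions.

(** * Weak derivatives in H^1_0 *)

Section weak_derivatives.
Context {R : realType} {d : nat}.
Local Notation mu := (lebesgue_rV R d).
Implicit Types (Om : set 'rV[R]_d) (g h : 'rV[R]_d -> R).

Lemma weak_partialP Om i g : H1 Om g ->
  L2 Om (weak_partial Om i g) /\ is_weak_partial Om i g (weak_partial Om i g).
Proof. by move=> [_ /(_ i)] /getPex. Qed.

Lemma restrictM Om g h :
  (fun x => g x * h x) \_ Om = (fun x => (g \_ Om) x * (h \_ Om) x).
Proof. by apply/funext => x; rewrite !patchE; case: ifP; rewrite ?mul0r. Qed.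

Lemma integrable_weak_partialM Om i j g h : H1 Om g -> H1 Om h ->
  mu.-integrable setT (EFin \o (fun x =>
    (weak_partial Om i g \_ Om) x * (weak_partial Om j h \_ Om) x)).
Proof.
move=> Hg Hh; apply/Lfun1_integrable; apply: Lfun2_mul_Lfun1.
  exact: (weak_partialP i Hg).1.
exact: (weak_partialP j Hh).1.
Qed.

(** The weak derivative [w] is orthogonal to all test functions since [g] is
    null, and membership in H^1_0 approximates [w] by the test functions
    [partial i phi], so that [Lfun2_sqr_eq0] applies. *)
Lemma weak_partial_ae0 Om i g : H10 Om g ->
  {ae mu, forall x, Om x -> g x = 0} ->
  \int[mu]_(x in Om) (weak_partial Om i g x ^+ 2) = 0.
Proof.
move=> [Hg dense] g0; have [Lw weakw] := weak_partialP i Hg.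
set w := weak_partial Om i g in Lw weakw *.
have mg : measurable_fun setT (g \_ Om).
  by have [/sub_Lfun_mfun] := Hg; rewrite inE.
have -> : \int[mu]_(x in Om) (w x ^+ 2) = \int[mu]_x ((w \_ Om) x ^+ 2).
  rewrite Rintegral_mkcond; apply: eq_Rintegral => x _.
  by rewrite !patchE; case: ifP => //; rewrite expr0n.
apply: Lfun2_sqr_eq0 => // e /dense[phi [tphi _ /(_ i) close]].
have tdphi := test_function_partial i tphi.
have mdphi := measurable_partial i tphi.
exists (partial i phi); split => //.
  transitivity (\int[mu]_(x in Om) (w x * partial i phi x)).
    by rewrite [RHS]Rintegral_mkcond restrictM (test_function_restrict tdphi).
  (* The weak derivative identity is tested with partial i phi, not phi: this
     moves a second derivative of phi onto the null function g. *)
  have := weakw _ tdphi; set dd := partial i (partial i phi).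
  suff -> : \int[mu]_(x in Om) (g x * dd x) = 0.
    by move/eqP; rewrite eq_sym oppr_eq0 => /eqP.
  have tdd : test_function Om dd by exact: test_function_partial.
  rewrite Rintegral_mkcond restrictM (test_function_restrict tdd).
  rewrite /Rintegral (ae_eq_integral (cst 0%E))//; first by rewrite integral0.
    apply/measurable_EFinP; apply: measurable_funM => //.
    exact: measurable_partial tdphi.
  apply: filterS g0 => x gx _ /=.
  by rewrite patchE; case: ifPn => [/set_mem/gx->|_]; rewrite mul0r.
rewrite (_ : _ \o _ = EFin \o ((partial i phi \- w)%R \_ Om))//.
apply/funext => x /=; rewrite -{1}(test_function_restrict tdphi) !patchE.
by case: ifP => //; rewrite subr0.
Qed.

End weak_derivatives.

(** * The gradient norm and its dual *)

Section gradient_norm.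
Context {R : realType} {d : nat}.
Local Notation mu := (lebesgue_rV R d).
Implicit Types (Om : set 'rV[R]_d) (v : 'rV[R]_d -> 'rV[R]_d).

Lemma ddot_ge0 (A : 'M[R]_d) : 0 <= ddot A A.
Proof.
apply: sumr_ge0 => i _; apply: sumr_ge0 => j _.
by rewrite -expr2 sqr_ge0.
Qed.

Lemma grad_norm_ge0 Om v : 0 <= grad_norm Om v.
Proof. by rewrite /grad_norm /Lp_norm fine_ge0// Lnorm_ge0. Qed.

Lemma grad_normX2 Om v :
  grad_norm Om v ^+ 2 = \int[mu]_(x in Om) ddot (grad Om v x) (grad Om v x).
Proof.
rewrite /grad_norm /Lp_norm (@fine_LnormX _ _ _ _ 2)// [RHS]Rintegral_mkcond.
apply: eq_Rintegral => x _; rewrite !patchE; case: ifP => _.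
  by rewrite real_normK ?num_real// sqr_sqrtr// ddot_ge0.
by rewrite normr0 expr0n.
Qed.

Lemma restrict_ddot_grad Om v :
  (fun x => ddot (grad Om v x) (grad Om v x)) \_ Om =
  (fun x => \sum_i \sum_j ((weak_partial Om j (component i v) \_ Om) x *
     (weak_partial Om j (component i v) \_ Om) x)).
Proof.
apply/funext => x; rewrite !patchE; case: ifPn => xOm; last first.
  rewrite big1// => i _; rewrite big1// => j _.
  by rewrite patchE (negbTE xOm) mul0r.
rewrite /ddot; apply: eq_bigr => i _; apply: eq_bigr => j _.
by rewrite !mxE patchE xOm.
Qed.

Lemma integrable_ddot_grad Om v : spaceX Om v ->
  mu.-integrable setT
    (EFin \o ((fun x => ddot (grad Om v x) (grad Om v x)) \_ Om)).
Proof.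
move=> Xv; rewrite restrict_ddot_grad.
rewrite (_ : _ \o _ = (fun x => \sum_i \sum_j
  ((weak_partial Om j (component i v) \_ Om) x *
     (weak_partial Om j (component i v) \_ Om) x)%:E)%E); last first.
  apply/funext => x /=; rewrite -sumEFin.
  by apply: eq_bigr => i _; rewrite -sumEFin.
apply: integrable_sum => // i _; apply: integrable_sum => // j _.
by apply: integrable_weak_partialM; exact: (Xv i).1.
Qed.

Lemma grad_norm_ae0 Om v : spaceX Om v ->
  {ae mu, forall x, Om x -> v x = 0} -> grad_norm Om v = 0.
Proof.
move=> Xv v0; apply/eqP; rewrite -sqrf_eq0 grad_normX2 Rintegral_mkcond.
rewrite restrict_ddot_grad /Rintegral.
under eq_integral do rewrite -sumEFin.
under eq_integral do under eq_bigr do rewrite -sumEFin.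
rewrite integral_sum//; last first.
  move=> i; apply: integrable_sum => // j _.
  by apply: integrable_weak_partialM; exact: (Xv i).1.
rewrite big1// => i _; rewrite integral_sum//; last first.
  by move=> j; apply: integrable_weak_partialM; exact: (Xv i).1.
rewrite big1// => j _.
have iw := integrable_weak_partialM j j (Xv i).1 (Xv i).1.
rewrite -[LHS]fineK; last exact: integrable_fin_num iw.
congr EFin; rewrite -(weak_partial_ae0 j (Xv i)); last first.
  by apply: filterS v0 => x vx Ox; rewrite /component vx// mxE.
by rewrite [RHS]Rintegral_mkcond restrictM.
Qed.

(** If the gradient norm of [v] is 0 then [f v = 0] by boundedness of [f], so
    both sides vanish; otherwise [v] is not null by [grad_norm_ae0], and its
    quotient is one of those whose supremum is the dual norm. *)
Lemma dual_norm_bound Om f v : dualX Om f -> spaceX Om v ->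
  f v <= dual_norm Om f * grad_norm Om v.
Proof.
move=> [_ [C fC]] Xv; have fv := fC _ Xv.
have [G0|Gn0] := eqVneq (grad_norm Om v) 0.
  by move: fv; rewrite G0 !mulr0 normr_le0 => /eqP ->.
have G0 : 0 < grad_norm Om v by rewrite lt_def Gn0 grad_norm_ge0.
rewrite -ler_pdivrMr//; apply: ub_le_sup; last first.
  exists v => //; split => // v0.
  by move/eqP: Gn0; apply; exact: grad_norm_ae0.
(* C may be negative, whereas a quotient by a zero gradient norm is 0. *)
exists `|C| => _ [w [Xw _] <-].
have [->|wn0] := eqVneq (grad_norm Om w) 0; first by rewrite invr0 mulr0.
have w0 : 0 < grad_norm Om w by rewrite lt_def wn0 grad_norm_ge0.
apply: le_trans (ler_norm C); rewrite (ler_pdivrMr _ _ w0).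
exact: le_trans (ler_norm _) (fC _ Xw).
Qed.

End gradient_norm.

(** * Stability of the pointwise penalty method *)

Theorem theorem3p3 (R : realType) (d : nat) (nu TOL : R)
    (Om : set 'rV[R]_d) (N : nat) (T : 'I_N -> set 'rV[R]_d)
    (Xh : set ('rV[R]_d -> 'rV[R]_d)) (f : ('rV[R]_d -> 'rV[R]_d) -> R)
    (u : 'rV[R]_d -> 'rV[R]_d)
    (hd : d = 2%N \/ d = 3%N) (hOm : polytopal_domain Om)
    (hnu : 0 < nu) (hTOL : 0 < TOL)
    (hT : conforming_mesh Om T) (hXh : fe_space Om T Xh)
    (hf : dualX Om f)
    (hu : pp_solution nu TOL Om T Xh f u) :
  nu / 2 * grad_norm Om u ^+ 2 +
  \sum_(K < N) (LocTol Om TOL (T K))^-1 *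
    fine (Lp_norm 4%:E (T K) (divergence Om u)) ^+ 4
  <= (2 * nu)^-1 * dual_norm Om f ^+ 2.
Proof.
have [Xhu solu] := hu; have Xu : spaceX Om u by have [+ _ _ _] := hXh; exact.
have := dual_norm_bound hf Xu; rewrite -(solu u Xhu).
have -> : \int[lebesgue_rV R d]_(x in Om)
    (nu * ddot (grad Om u x) (grad Om u x)) = nu * grad_norm Om u ^+ 2.
  rewrite grad_normX2 Rintegral_mkcond [in RHS]Rintegral_mkcond.
  rewrite -RintegralZl//; last exact: integrable_ddot_grad.
  by apply: eq_Rintegral => x _; rewrite !patchE; case: ifP; rewrite ?mulr0.
under eq_bigr => K _.
  rewrite (_ : Rintegral _ _ _ =
    fine (Lp_norm 4%:E (T K) (divergence Om u)) ^+ 4); last first.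
    rewrite /Lp_norm (@fine_LnormX _ _ _ _ 4)// Rintegral_mkcond.
    apply: eq_Rintegral => x _; rewrite !patchE; case: ifP => _.
      by rewrite -expr2 -{1}[X in _ * X]real_normK ?num_real// -exprD.
    by rewrite normr0 expr0n.
  over.
set S := \sum_(K < N) _; set G := grad_norm _ _; set F := dual_norm _ _.
move=> energy.
have young : F * G <= nu / 2 * G ^+ 2 + (2 * nu)^-1 * F ^+ 2.
  rewrite -subr_ge0.
  have -> : nu / 2 * G ^+ 2 + (2 * nu)^-1 * F ^+ 2 - F * G =
      (2 * nu)^-1 * (F - nu * G) ^+ 2 by field; rewrite gt_eqF.
  by rewrite mulr_ge0 ?sqr_ge0// invr_ge0 mulr_ge0 ?ltW.
by move: energy young; lra.
Qed.
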